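(* Let $k$ be an algebraic extension of $\mathbb{F}_q$ and let $I\subseteq k[x_0,\dots,x_m]$ be the vanishing ideal over $k$ of the set $\mathbb{P}^m(\mathbb{F}_q)\subseteq\mathbb{P}^m(k)$. Then every element of $k[x_0,\dots,x_m]/I$ can be uniquely written as $f+I$, where $f\in k[x_0,\dots,x_m]$ is a projectively reduced polynomial. Moreover, every element of $k[x_0,\dots,x_m]/\mathrm{LT}(I)$ can also be uniquely written as $f+\mathrm{LT}(I)$, where $f\in k[x_0,\dots,x_m]$ is a projectively reduced polynomial.
   Context: $q$ is a prime power, $\mathbb{F}_q$ is the finite field with $q$ elements, and $m$ is a positive integer. The vanishing ideal over $k$ of a subset $X$ of $\mathbb{P}^m(k)$ is the ideal of $k[x_0,\dots,x_m]$ generated by the homogeneous polynomials that vanish at every point of $X$. A monomial order $\preccurlyeq$ on the set $\mathbb{M}$ of all monomials in $x_0,\dots,x_m$ is fixed, with $x_0\succ x_1\succ\cdots\succ x_m$; $\mathrm{lm}(f)$ denotes the leading monomial of a nonzero polynomial $f$, and $\mathrm{LT}(I)$ is the ideal of $k[x_0,\dots,x_m]$ generated by $\{\mathrm{lm}(f): f\in I,\ f\ne 0\}$. Projective reduction: put $\overline{1}:=1$. If $\mu\in\mathbb{M}$, $\mu\neq 1$, write uniquely $\mu=x_0^{a_0}\cdots x_\ell^{a_\ell}$ with $0\le \ell\le m$, $a_i\ge 0$ and $a_\ell>0$. For $0\le i\le \ell-1$ let $\overline{a}_i=a_i$ if $0\le a_i\le q-1$, and if $a_i\ge q$ let $\overline{a}_i$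 be the unique integer with $1\le\overline{a}_i\le q-1$ and $\overline{a}_i\equiv a_i\pmod{q-1}$. Define $$\overline{\mu}:=x_0^{\overline{a}_0}\cdots x_{\ell-1}^{\overline{a}_{\ell-1}}x_\ell^{a_\ell+\sum_{i=0}^{\ell-1}(a_i-\overline{a}_i)}.$$ Extend $\mu\mapsto\overline{\mu}$ to a $k$-linear map $f\mapsto\overline{f}$ on $k[x_0,\dots,x_m]$. A polynomial $f$ is projectively reduced if $\overline{f}=f$. *)

(* Defs.v *)
From HB Require Import structures.
From mathcomp Require Import all_boot all_order all_algebra.
From mathcomp Require Import mpoly boolp.

Set Implicit Arguments.
Unset Strict Implicit.
Unset Printing Implicit Defensive.

Import Order.TTheory GRing.Theory.

Local Open Scope ring_scope.

Definition ideal_gen_pred (R : comNzRingType) (G : R -> Prop) : pred R :=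
  fun f => `[< exists s : seq (R * R),
    (forall p, p \in s -> G p.2) /\ f = \sum_(p <- s) p.1 * p.2 >].

Lemma ideal_gen_zmod_closed (R : comNzRingType) (G : R -> Prop) :
  zmod_closed (ideal_gen_pred G).
Proof.
split=> [|f g /asboolP [s [Gs ->]] /asboolP [t [Gt ->]]].
  by apply/asboolP; exists [::]; rewrite big_nil.
apply/asboolP; exists (s ++ [seq (- p.1, p.2) | p <- t]); split.
  move=> p; rewrite mem_cat => /orP[/Gs //|/mapP[r rt ->]]; exact: Gt rt.
rewrite big_cat big_map /= -sumrN; congr (_ + _).
by apply: eq_bigr => p _; rewrite mulNr.
Qed.

HB.instance Definition _ (R : comNzRingType) (G : R -> Prop) :=
  GRing.isZmodClosed.Build R (ideal_gen_pred G) (ideal_gen_zmod_closed G).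

(* The structure zmodClosed is what {ideal_quot _} requires. *)
Definition ideal_gen (R : comNzRingType) (G : R -> Prop) : zmodClosed R :=
  GRing.ZmodClosed.clone R (ideal_gen_pred G) _.

Lemma ideal_genM (R : comNzRingType) (G : R -> Prop) (a f : R) :
  f \in ideal_gen G -> a * f \in ideal_gen G.
Proof.
move=> /asboolP [s [Gs ->]]; apply/asboolP.
exists [seq (a * p.1, p.2) | p <- s]; split.
  by move=> p /mapP[r rs ->]; exact: Gs rs.
by rewrite big_map mulr_sumr; apply: eq_bigr => p _; rewrite mulrA.
Qed.

Lemma mem_ideal_gen (R : comNzRingType) (G : R -> Prop) (f : R) :
  G f -> f \in ideal_gen G.
Proof.
move=> Gf; apply/asboolP; exists [:: (1, f)]; split.
  by move=> p; rewrite inE => /eqP ->.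
by rewrite big_seq1 mul1r.
Qed.

(* P^m(k), as the set of lines of k^(m+1) *)
Definition proj_space (k : fieldType) (m : nat) : Type :=
  {L : {vspace 'rV[k]_m.+1} | \dim L == 1%N}.

(* P^m(F) inside P^m(k), for a subfield iota : F -> k: the lines that have a
   representative with homogeneous coordinates in F *)
Definition rational_point (F k : fieldType) (iota : {rmorphism F -> k})
    (m : nat) (P : proj_space k m) : Prop :=
  exists2 v : 'rV[F]_m.+1, v != 0 & val P = <[map_mx iota v]>%VS.

Definition vanishes_at (k : fieldType) (m : nat) (f : {mpoly k[m.+1]})
    (P : proj_space k m) : Prop :=
  forall v : 'rV[k]_m.+1, v \in val P -> v != 0 -> f.@[fun i => v 0 i] = 0.

Definition vanishing_ideal (k : fieldType) (m : nat)
    (X : proj_space k m -> Prop) : zmodClosed {mpoly k[m.+1]} :=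
  ideal_gen (fun f => (exists d, f \is d.-homog) /\
                      forall P, X P -> vanishes_at f P).

Definition monomial_order (n : nat) (ord : rel 'X_{1..n}) : Prop :=
  [/\ total ord, antisymmetric ord, transitive ord,
      forall mu, ord 0%MM mu
    & forall mu nu tau, ord mu nu -> ord (mu + tau)%MM (nu + tau)%MM].

(* [mlead] of the library is tied to one specific order; this is the leading
   monomial for an arbitrary one.  It is 0%MM (the monomial 1) if f = 0. *)
Definition lm (n : nat) (R : nzRingType) (ord : rel 'X_{1..n})
    (f : {mpoly R[n]}) : 'X_{1..n} :=
  foldr (fun mu nu => if ord mu nu then nu else mu) 0%MM (msupp f).

Lemma lmP (n : nat) (R : nzRingType) (ord : rel 'X_{1..n})
    (f : {mpoly R[n]}) : monomial_order ord -> f != 0 ->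
  lm ord f \in msupp f /\ forall mu, mu \in msupp f -> ord mu (lm ord f).
Proof.
move=> [tot anti tr ord0 _]; rewrite -msupp_eq0 /lm.
have refl mu : ord mu mu by case/orP: (tot mu mu).
elim: (msupp f) => //= mu s IHs _.
have [->|s0] := eqVneq s [::].
  rewrite /= inE; case: ifP => [mu0|_].
    have -> : mu = 0%MM by apply: anti; rewrite mu0 ord0.
    by split=> // nu; rewrite inE => /eqP ->.
  by split=> // nu; rewrite inE => /eqP ->.
have [ins ub] := IHs s0; set t := foldr _ _ _ in ins ub *.
case: ifP => [mut|/negbT mut].
  split; first by rewrite inE ins orbT.
  by move=> nu; rewrite inE => /orP[/eqP -> //|/ub].
have tmu : ord t mu by case/orP: (tot mu t) => // h; rewrite h in mut.
split; first by rewrite inE eqxx.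
move=> nu; rewrite inE => /orP[/eqP -> //|/ub h]; exact: tr h tmu.
Qed.

Definition LT (n : nat) (R : comNzRingType) (ord : rel 'X_{1..n})
    (I : {pred {mpoly R[n]}}) : zmodClosed {mpoly R[n]} :=
  ideal_gen (fun g => exists f, [/\ f \in I, f != 0 & g = 'X_[lm ord f]]).

Definition red_exp (q a : nat) : nat :=
  if (a <= q.-1)%N then a else (a.-1 %% q.-1).+1.

Lemma red_expP (q a : nat) : (1 < q)%N -> (q <= a)%N ->
  (1 <= red_exp q a <= q.-1)%N /\ red_exp q a = a %[mod q.-1].
Proof.
case: q => [|[|q]] //= _ qa; rewrite /red_exp /= [(a <= _)%N]leqNgt qa /=.
rewrite ltn_mod /=; split=> //.
by rewrite -[in LHS]addn1 modnDml addn1 prednK // (ltn_trans _ qa).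
Qed.

Definition last_var (m : nat) (mu : 'X_{1..m.+1}) : nat :=
  \max_(i < m.+1 | (0 < mu i)%N) i.

Definition proj_red_mnm (q m : nat) (mu : 'X_{1..m.+1}) : 'X_{1..m.+1} :=
  if mu == 0%MM then 0%MM else
  let l := last_var mu in
  [multinom
    (if (i < l)%N then red_exp q (mu i)
     else if i == l :> nat then
       (mu i + \sum_(j < m.+1 | (j < l)%N) (mu j - red_exp q (mu j)))%N
     else 0%N) | i < m.+1].

Definition proj_red (q m : nat) (k : nzRingType) (f : {mpoly k[m.+1]}) :
    {mpoly k[m.+1]} :=
  \sum_(mu <- msupp f) f@_mu *: 'X_[proj_red_mnm q mu].

Definition projectively_reduced (q m : nat) (k : nzRingType)
    (f : {mpoly k[m.+1]}) : Prop :=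
  proj_red q f = f.

(* Main.v *)
(** Reduction replaces a monomial by one with the same degree and the same
    values at the points of [F^(m+1)], so [f - proj_red f] lies in [I].
    Conversely a reduced [f] in [I] is zero: each homogeneous component of [f]
    vanishes on nonzero [F]-points, and at the points (v_0, .., v_(l-1), 1, 0,
    .., 0) a reduced form becomes a polynomial with exponents less than [q],
    which Lagrange interpolation determines from its values.

    As x_0 > .. > x_m, reduction does not increase monomials.  A non-reduced
    [mu] is therefore the leading monomial of [mu - proj_red mu] in [I].  If a
    reduced [mu] were the leading monomial of some [h] in [I], then [proj_red h]
    would be a reduced element of [I], hence zero, although its coefficient at
    [mu] is that of [h]. *)
Require Import Defs.
From HB Require Import structures.
From mathcomp Require Import all_boot all_order all_algebra.
From mathcomp Require Import finfield.
From mathcomp Require Import mpoly boolp.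

Set Implicit Arguments.
Unset Strict Implicit.
Unset Printing Implicit Defensive.

Import Order.TTheory GRing.Theory.

Local Open Scope ring_scope.
Local Open Scope quotient_scope.

(** * Reduction of exponents modulo [q - 1] *)

Lemma red_exp_decomp q a : exists c, a = (red_exp q a + c * q.-1)%N.
Proof.
rewrite /red_exp; case: leqP => [_|qa]; first by exists 0%N; rewrite addn0.
exists (a.-1 %/ q.-1)%N; rewrite addSn addnC -divn_eq prednK //.
exact: leq_ltn_trans qa.
Qed.

Lemma red_exp_le q a : (red_exp q a <= a)%N.
Proof. by have [c {2}->] := red_exp_decomp q a; exact: leq_addr. Qed.

Lemma dvdn_red_exp q a : (q.-1 %| a - red_exp q a)%N.
Proof.
by have [c {1}->] := red_exp_decomp q a; rewrite addKn dvdn_mull.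
Qed.

Lemma red_exp_ltn q a : (1 < q)%N -> (red_exp q a < q)%N.
Proof.
case: q => [|[|q]] // _; rewrite /red_exp.
by case: ifP => // _; rewrite ltnS ltn_pmod.
Qed.

Lemma red_exp_small q a : (a < q)%N -> red_exp q a = a.
Proof. by case: q => // q; rewrite ltnS /red_exp /= => ->. Qed.

(** Taking residues in 1, .., q - 1 rather than 0, .., q - 2 keeps every variable that occurs, so
    values at points with zero coordinates survive reduction. *)
Lemma red_exp_eq0 q a : (red_exp q a == 0)%N = (a == 0)%N.
Proof. by rewrite /red_exp; case: leqP => //; case: a. Qed.

(** Each induction step turns one factor [x ^+ #|F|] into [x]. Positivity of [a] takes care of
    [x = 0], where exponent 0 would give 1. *)
Lemma expf_dvd_card (F : finFieldType) (x : F) a d :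
  (0 < a)%N -> (#|F|.-1 %| d)%N -> x ^+ (a + d) = x ^+ a.
Proof.
case: a => // a _ /dvdnP[c ->]; elim: c => [|c IHc]; first by rewrite addn0.
have F1 := finNzRing_gt1 F.
have -> : (a.+1 + c.+1 * #|F|.-1 = a + c * #|F|.-1 + #|F|.-1.+1)%N.
  by rewrite mulSnr addnA addnS !addSn.
rewrite prednK ?(ltnW F1) // exprD expf_card.
by rewrite -exprSr -addSn.
Qed.

Lemma expf_red_exp (F : finFieldType) (x : F) a :
  x ^+ red_exp #|F| a = x ^+ a.
Proof.
have [->|a0] := posnP a; first by rewrite red_exp_small // ltnW ?finNzRing_gt1.
have r0 : (0 < red_exp #|F| a)%N by rewrite lt0n red_exp_eq0 -lt0n.
by rewrite -[in RHS](subnKC (red_exp_le #|F| a)) expf_dvd_card ?dvdn_red_exp.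
Qed.

(** * The last variable and the reduction of monomials *)

Lemma last_var_lt m (mu : 'X_{1..m.+1}) : (last_var mu < m.+1)%N.
Proof. by rewrite ltnS; apply/bigmax_leqP => i _; rewrite -ltnS. Qed.

Lemma mnm_after_last_var m (mu : 'X_{1..m.+1}) (j : 'I_m.+1) :
  (last_var mu < j)%N -> mu j = 0%N.
Proof.
move=> lj; apply/eqP; rewrite -leqn0 leqNgt; apply: contraTN lj => muj.
by rewrite -leqNgt (leq_bigmax_cond (F := @nat_of_ord m.+1)).
Qed.

Lemma last_varP m (mu : 'X_{1..m.+1}) : mu != 0%MM ->
  exists2 l : 'I_m.+1, last_var mu = l & (0 < mu l)%N.
Proof.
move=> mu0; have [i mui] : exists i, mu i != 0%N.
  apply/existsP; apply: contraNT mu0; rewrite negb_exists => /forallP h.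
  by apply/eqP/mnmP => i; rewrite mnmE; apply/eqP; have := h i; rewrite negbK.
have cA : (0 < #|[pred i | (0 < mu i)%N]|)%N.
  by apply/card_gt0P; exists i; rewrite inE lt0n.
have [l] := eq_bigmax_cond (@nat_of_ord m.+1) cA.
by rewrite inE => mul lE; exists l.
Qed.

Lemma last_var_eq m (mu : 'X_{1..m.+1}) (l : 'I_m.+1) : (0 < mu l)%N ->
  (forall j : 'I_m.+1, (l < j)%N -> mu j = 0%N) -> last_var mu = l.
Proof.
move=> mul h; apply/eqP; rewrite eqn_leq; apply/andP; split.
  apply/bigmax_leqP => j; rewrite lt0n leqNgt; apply: contraNN.
  by move=> /h ->.
exact: (leq_bigmax_cond (F := @nat_of_ord m.+1)).
Qed.

Definition mnm_below m (l : 'I_m.+1) (c : 'I_m.+1 -> nat) : 'X_{1..m.+1} :=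
  (\sum_(j < m.+1 | (j < l)%N) U_(j) *+ c j)%MM.

Lemma mnm_belowE m (l : 'I_m.+1) c i :
  mnm_below l c i = if (i < l)%N then c i else 0%N.
Proof.
rewrite /mnm_below mnm_sumE; case: ifP => il.
  rewrite (bigD1 i) //= big1 ?addn0 ?mulmnE ?mnm1E ?eqxx ?mul1n //.
  by move=> j /andP[_ ji]; rewrite mulmnE mnm1E (negbTE ji).
rewrite big1 // => j jl; rewrite mulmnE mnm1E; case: eqP => // ji.
by rewrite ji il in jl.
Qed.

(* The common part [nu] of [mu] and its reduction is left in place, while each
   [x_j] with [j < l] gives up [c j] factors, all turned into [x_l]. *)
Lemma proj_red_mnmP q m (mu : 'X_{1..m.+1}) : mu != 0%MM ->
  exists (l : 'I_m.+1) (nu : 'X_{1..m.+1}) (c : 'I_m.+1 -> nat),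
  [/\ last_var mu = l,
      [/\ (0 < nu l)%N, (forall i : 'I_m.+1, (l < i)%N -> nu i = 0%N)
        & forall i : 'I_m.+1, (i < l)%N -> nu i = red_exp q (mu i)],
      forall j, (q.-1 %| c j)%N,
      mu = (nu + mnm_below l c)%MM
    & proj_red_mnm q mu = (nu + U_(l) *+ \sum_(j < m.+1 | (j < l)%N) c j)%MM].
Proof.
move=> mu0; have [l lE mul] := last_varP mu0.
have h (j : 'I_m.+1) : (l < j)%N -> mu j = 0%N.
  by rewrite -lE; exact: mnm_after_last_var.
pose c j := (mu j - red_exp q (mu j))%N.
exists l, [multinom if (i < l)%N then red_exp q (mu i) else mu i | i < m.+1], c.
split=> //.
- split=> [|i li|i il]; rewrite mnmE ?ltnn // ?il //.
  by rewrite ltnNge ltnW //= h.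
- by move=> j; exact: dvdn_red_exp.
- apply/mnmP => i; rewrite mnmDE mnmE mnm_belowE.
  by case: ifP => _; rewrite ?addn0 // subnKC ?red_exp_le.
- apply/mnmP => i; rewrite /proj_red_mnm (negbTE mu0) lE.
  rewrite mnmDE mulmnE mnm1E !mnmE.
  case: ltngtP => [il|li|/val_inj ->]; rewrite ?eqxx ?mul1n //.
    have /negbTE -> : l != i by apply: contraTneq il => ->; rewrite ltnn.
    by rewrite mul0n addn0.
  have /negbTE -> : l != i by apply: contraTneq li => ->; rewrite ltnn.
  by rewrite h.
Qed.

Lemma proj_red_mnm0 q m : proj_red_mnm q (0%MM : 'X_{1..m.+1}) = 0%MM.
Proof. by rewrite /proj_red_mnm eqxx. Qed.

Lemma mdeg_proj_red_mnm q m (mu : 'X_{1..m.+1}) :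
  mdeg (proj_red_mnm q mu) = mdeg mu.
Proof.
have [->|mu0] := eqVneq mu 0%MM; first by rewrite proj_red_mnm0.
have [l [nu [c [_ _ _ muE ->]]]] := proj_red_mnmP q mu0; rewrite {}muE.
rewrite !mdegD mdegMn mdeg1 mul1n mdeg_sum; congr (_ + _)%N.
by apply: eq_bigr => j _; rewrite mdegMn mdeg1 mul1n.
Qed.

(** After one reduction the exponents before [l] are less than [q], and that of x_l has only grown:
    [l] is still the last variable and nothing is left to move. *)
Lemma proj_red_mnm_idem q m (mu : 'X_{1..m.+1}) : (1 < q)%N ->
  proj_red_mnm q (proj_red_mnm q mu) = proj_red_mnm q mu.
Proof.
move=> q1; have [->|mu0] := eqVneq mu 0%MM; first by rewrite !proj_red_mnm0.
have [l [nu [c [_ [nul nu0 nur] _ _ ->]]]] := proj_red_mnmP q mu0.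
set D := (\sum_(j < _ | _) _)%N; set la := (nu + _)%MM.
have laE i : la i = (nu i + (l == i) * D)%N by rewrite mnmDE mulmnE mnm1E.
have lal : (0 < la l)%N by rewrite laE ltn_addr.
have la0 (j : 'I_m.+1) : (l < j)%N -> la j = 0%N.
  move=> lj; have /negbTE l_j : l != j by apply: contraTneq lj => ->; rewrite ltnn.
  by rewrite laE nu0 // l_j.
have lar (j : 'I_m.+1) : (j < l)%N -> red_exp q (la j) = la j.
  move=> jl; have /negbTE lj : l != j by apply: contraTneq jl => ->; rewrite ltnn.
  by rewrite laE lj addn0 nur // red_exp_small ?red_exp_ltn.
have /negbTE laN0 : la != 0%MM.
  by apply: contraTneq lal => ->; rewrite mnmE.
apply/mnmP => i; rewrite /proj_red_mnm laN0 (last_var_eq lal la0) mnmE.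
case: ltngtP => [il|li|]; [exact: lar | by rewrite la0 | move=> _].
by rewrite big1 ?addn0 // => j jl; rewrite lar // subnn.
Qed.

Lemma proj_red_mnm_ltn q m (mu : 'X_{1..m.+1}) (i : 'I_m.+1) : (1 < q)%N ->
  proj_red_mnm q mu = mu -> (i < last_var mu)%N -> (mu i < q)%N.
Proof.
move=> q1; have [->|mu0] := eqVneq mu 0%MM.
  by move=> _ _; rewrite mnmE; exact: ltnW.
move=> muE il; rewrite -muE /proj_red_mnm (negbTE mu0) mnmE il; exact: red_exp_ltn.
Qed.

(** * Effect of reduction on the monomial order and on values *)

Lemma ord_mnmD n (ord : rel 'X_{1..n}) mu nu la ka : monomial_order ord ->
  ord mu nu -> ord la ka -> ord (mu + la)%MM (nu + ka)%MM.
Proof.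
move=> [_ _ tr _ od] h1 h2; apply: tr (od _ _ _ h1) _.
by rewrite ![(nu + _)%MM]addmC; exact: od.
Qed.

Lemma ord_mulmn n (ord : rel 'X_{1..n}) mu nu c : monomial_order ord ->
  ord mu nu -> ord (mu *+ c)%MM (nu *+ c)%MM.
Proof.
move=> ho h; elim: c => [|c IHc]; first by rewrite !mulm0n; case: ho.
by rewrite !mulmS; exact: ord_mnmD.
Qed.

Lemma ord_proj_red_mnm q m (ord : rel 'X_{1..m.+1}) (mu : 'X_{1..m.+1}) :
  monomial_order ord ->
  (forall i j : 'I_m.+1, (i < j)%N -> ord U_(j)%MM U_(i)%MM) ->
  ord (proj_red_mnm q mu) mu.
Proof.
move=> ho hvar; have ord0 nu : ord 0%MM nu by case: ho.
have refl nu : ord nu nu by case: ho => tot *; case/orP: (tot nu nu).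
have [->|mu0] := eqVneq mu 0%MM; first by rewrite proj_red_mnm0.
have [l [nu [c [_ _ _ muE ->]]]] := proj_red_mnmP q mu0; rewrite {}muE.
apply: ord_mnmD => //.
(* Spread the power of x_l over the index set of [mnm_below], so that the two products are compared
   factor by factor. *)
rewrite (_ : (_ *+ _)%MM =
  (\sum_(j < m.+1 | (j < l)%N) U_(l) *+ c j)%MM :> 'X_{1..m.+1}); last first.
  apply/mnmP => i; rewrite mulmnE mnm_sumE big_distrr /=.
  by apply: eq_bigr => j _; rewrite mulmnE.
apply: (big_ind2 (fun x y => ord x y)) => [||j jl]; first exact: ord0.
  by move=> *; exact: ord_mnmD.
by apply: ord_mulmn => //; exact: hvar.
Qed.

(** Before [l] this is x^q = x. At [l] the exponent grows by a multiple of q - 1 from the positive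
    [nu l], which leaves the value unchanged even if the coordinate is 0. *)
Lemma prod_proj_red_mnm (F : finFieldType) m (mu : 'X_{1..m.+1})
    (v : 'I_m.+1 -> F) :
  \prod_i v i ^+ proj_red_mnm #|F| mu i = \prod_i v i ^+ mu i.
Proof.
have [->|mu0] := eqVneq mu 0%MM; first by rewrite proj_red_mnm0.
have [l [nu [c [_ [nul _ nur] dc muE ->]]]] := proj_red_mnmP #|F| mu0.
have {muE} muE i : mu i = (nu i + if (i < l)%N then c i else 0)%N.
  by rewrite [in LHS]muE mnmDE mnm_belowE.
apply: eq_bigr => i _; rewrite mnmDE mulmnE mnm1E.
have [il|li|/val_inj ->] := ltngtP i l.
- have /negbTE -> : l != i by apply: contraTneq il => ->; rewrite ltnn.
  by rewrite mul0n addn0 nur // expf_red_exp.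
- have /negbTE -> : l != i by apply: contraTneq li => ->; rewrite ltnn.
  by rewrite mul0n [in RHS]muE ltnNge (ltnW li) /= !addn0.
- rewrite eqxx mul1n [in RHS]muE ltnn addn0 expf_dvd_card //.
  by apply: dvdn_sum.
Qed.

(** * Reduction of polynomials *)

Lemma mcoeff_proj_red q m (k : nzRingType) (f : {mpoly k[m.+1]}) mu :
  (proj_red q f)@_mu =
    \sum_(nu <- msupp f | proj_red_mnm q nu == mu) f@_nu.
Proof.
rewrite /proj_red raddf_sum /= big_mkcond [RHS]big_mkcond /=.
apply: eq_bigr => nu _; rewrite mcoeffZ mcoeffX.
by case: eqP => _; rewrite ?mulr1 ?mulr0.
Qed.

Lemma mem_msupp_proj_red q m (k : nzRingType) (f : {mpoly k[m.+1]}) mu :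
  mu \in msupp (proj_red q f) ->
  exists2 nu, nu \in msupp f & mu = proj_red_mnm q nu.
Proof.
rewrite mcoeff_msupp mcoeff_proj_red => h.
have /hasP[nu nuf /eqP <-] : has (fun nu => proj_red_mnm q nu == mu) (msupp f).
  by apply: contraNT h => h; rewrite big_hasC.
by exists nu.
Qed.

(** Coefficients may merge or cancel in [proj_red q f], but each monomial that remains is a
    reduction, hence fixed by idempotence. *)
Lemma projectively_reducedP q m (k : nzRingType) (f : {mpoly k[m.+1]}) :
  (1 < q)%N ->
  projectively_reduced q f <->
  (forall mu, mu \in msupp f -> proj_red_mnm q mu = mu).
Proof.
move=> q1; split=> [fE mu|h].
  by rewrite -fE => /mem_msupp_proj_red[nu _ ->]; exact: proj_red_mnm_idem.
rewrite /projectively_reduced /proj_red [RHS]mpolyE.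
by apply: eq_big_seq => mu /h ->.
Qed.

Lemma proj_red_reduced q m (k : nzRingType) (f : {mpoly k[m.+1]}) :
  (1 < q)%N -> projectively_reduced q (proj_red q f).
Proof.
move=> q1; apply/projectively_reducedP => // mu /mem_msupp_proj_red[nu _ ->].
exact: proj_red_mnm_idem.
Qed.

Lemma projectively_reducedB q m (k : nzRingType) (f g : {mpoly k[m.+1]}) :
  (1 < q)%N -> projectively_reduced q f -> projectively_reduced q g ->
  projectively_reduced q (f - g).
Proof.
move=> q1 /(projectively_reducedP _ q1) hf /(projectively_reducedP _ q1) hg.
apply/projectively_reducedP => // mu; rewrite mcoeff_msupp mcoeffB => fg.
have [/hf //|/memN_msupp_eq0 f0] := boolP (mu \in msupp f).
by apply: hg; rewrite mcoeff_msupp; apply: contraNneq fg => ->; rewrite f0 subr0.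
Qed.

Lemma sub_proj_redE q m (k : nzRingType) (f : {mpoly k[m.+1]}) :
  f - proj_red q f =
    \sum_(mu <- msupp f) f@_mu *: ('X_[mu] - 'X_[proj_red_mnm q mu]).
Proof.
rewrite {1}[f]mpolyE /proj_red -sumrB.
by apply: eq_bigr => mu _; rewrite scalerBr.
Qed.

(** * Interpolation over a finite field *)

(* The columns of the inverse of the Vandermonde matrix [x ^+ b]: the monomial
   ['X^b] is interpolated by the polynomials [1 - ('X - x) ^+ (#|F| - 1)]. *)
Lemma card_dual_weights (F : finFieldType) :
  exists w : nat -> F -> F, forall a b, (a < #|F|)%N -> (b < #|F|)%N ->
    \sum_x w a x * x ^+ b = (b == a)%:R.
Proof.
have F1 := finNzRing_gt1 F.
pose L (x : F) : {poly F} := 1 - ('X - x%:P) ^+ #|F|.-1.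
exists (fun a x => (L x)`_a) => a b _ bF.
suff XE : \sum_x x ^+ b *: L x = 'X^b.
  move: (congr1 (fun p : {poly F} => p`_a) XE); rewrite coef_sum coefXn eq_sym.
  by move=> <-; apply: eq_bigr => x _; rewrite coefZ mulrC.
have sL x : (size (L x) <= #|F|)%N.
  apply: leq_trans (size_polyD _ _) _; rewrite size_polyN size_poly1.
  by rewrite size_exp_XsubC prednK ?(ltnW F1) // geq_max leqnn andbT (ltnW F1).
apply/eqP; rewrite -subr_eq0; apply/eqP.
(* The difference has degree less than [#|F|] and every element of [F] as a root. *)
apply: (@roots_geq_poly_eq0 _ _ (enum F)); rewrite ?enum_uniq //; last first.
  rewrite -cardE; apply: leq_trans (size_polyD _ _) _.
  rewrite size_polyN size_polyXn geq_max bF andbT.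
  apply: leq_trans (size_sum _ _ _) _; apply/bigmax_leqP => x _.
  exact: leq_trans (size_scale_leq _ _) (sL x).
apply/allP => y _; rewrite rootE !hornerE horner_sum (bigD1 y) //= big1.
  rewrite !hornerE subrr expr0n.
  have -> : (#|F|.-1 == 0)%N = false by case: #|F| F1 => [|[|c]].
  by rewrite mulr0n subr0 mulr1 subrr.
move=> x xy; rewrite !hornerE [X in 1 - X](_ : _ = 1) ?subrr ?mulr0 //.
have yx0 : y - x != 0 by rewrite subr_eq0 eq_sym.
by apply: (mulfI yx0); rewrite -exprS prednK ?(ltnW F1) // expf_card mulr1.
Qed.

(** * The vanishing ideal of the rational points *)

Section VanishingIdeal.

Variables (F : finFieldType) (k : fieldType) (iota : {rmorphism F -> k}).
Variable m : nat.

Local Notation I := (vanishing_ideal (@rational_point F k iota m)).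

Lemma vanishes_at_rationalP (f : {mpoly k[m.+1]}) (v : 'I_m.+1 -> F) :
  (forall P, rational_point iota P -> vanishes_at f P) ->
  (exists i, v i != 0) -> f.@[fun i => iota (v i)] = 0.
Proof.
move=> h [i vi]; pose r : 'rV[F]_m.+1 := \row_j v j.
have r0 : r != 0 by apply: contraNneq vi => /rowP/(_ i); rewrite !mxE => ->.
have ir0 : map_mx iota r != 0 by rewrite map_mx_eq0.
have dimr : \dim <[map_mx iota r]>%VS == 1%N by rewrite dim_vline ir0.
pose P : proj_space k m :=
  exist (fun L : {vspace 'rV[k]_m.+1} => is_true (\dim L == 1%N)) _ dimr.
have := h P (ex_intro2 _ _ r r0 (erefl _)) (map_mx iota r).
rewrite /= memv_line => /(_ isT ir0) fr0; rewrite -[RHS]fr0.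
by apply: meval_eq => j; rewrite !mxE.
Qed.

(* Evaluating at [(t v_0, ..., t v_m)] for an indeterminate [t] separates the
   homogeneous components; [k] may be too small for scalars to do so. *)
Lemma mem_vanishing_ideal_homog (f : {mpoly k[m.+1]}) (v : 'I_m.+1 -> F) d :
  f \in I -> (exists i, v i != 0) ->
  \sum_(mu <- msupp f | mdeg mu == d) f@_mu * iota (\prod_i v i ^+ mu i) = 0.
Proof.
move=> /asboolP[s [sG fE]] v0.
pose E (g : {mpoly k[m.+1]}) := mmap polyC (fun i => (iota (v i))%:P * 'X) g.
have EE g : E g = \sum_(mu <- msupp g)
    (g@_mu * iota (\prod_i v i ^+ mu i)) *: 'X^(mdeg mu).
  apply: eq_bigr => mu _; rewrite -mul_polyC polyCM -mulrA; congr (_ * _).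
  rewrite /mmap1 rmorph_prod rmorph_prod mdegE -prodrXr -big_split.
  by apply: eq_bigr => i _; rewrite exprMn !rmorphXn.
(* For a generator [g] of degree [e], [E g] is the value of [g] at an [F]-point times 'X^e, hence
   zero. *)
have Ef : E f = 0.
  rewrite fE /E raddf_sum big_seq big1 // => -[a g] /sG /= [[e /dhomogP ge] gv].
  rewrite rmorphM /= [X in _ * X](_ : _ = E g) // EE.
  rewrite (eq_big_seq (fun mu => (g@_mu * iota (\prod_i v i ^+ mu i)) *: 'X^e)).
    rewrite -scaler_suml -[X in X *: _](_ : g.@[fun i => iota (v i)] = _).
      by rewrite vanishes_at_rationalP // scale0r mulr0.
    rewrite mevalE; apply: eq_bigr => mu _; rewrite rmorph_prod.
    by congr (_ * _); apply: eq_bigr => i _; rewrite rmorphXn.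
  by move=> mu /ge <-.
have := congr1 (fun p : {poly k} => p`_d) Ef; rewrite EE coef0 coef_sum => Ed.
rewrite -[RHS]Ed big_mkcond; apply: eq_bigr => mu _; rewrite coefZ coefXn eq_sym.
by case: eqP => _; rewrite ?mulr1 ?mulr0.
Qed.

Lemma monomial_sub_proj_red_vanishing (mu : 'X_{1..m.+1}) :
  'X_[mu] - 'X_[proj_red_mnm #|F| mu] \in I.
Proof.
apply: mem_ideal_gen; split.
  by exists (mdeg mu); apply: rpredB; rewrite dhomogX //= mdeg_proj_red_mnm.
move=> P [v v0 PE] r; rewrite PE => /vlineP[c ->] _.
(* A representative over [k] is [c] times a vector over [F]; since degrees agree, both monomials
   acquire the same power of [c]. *)
have eval (nu : 'X_{1..m.+1}) :
    'X_[nu].@[fun i => (c *: map_mx iota v) 0 i] =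
    c ^+ mdeg nu * iota (\prod_i v 0 i ^+ nu i).
  rewrite mevalX rmorph_prod mdegE -prodrXr -big_split.
  by apply: eq_bigr => i _; rewrite !mxE exprMn rmorphXn.
rewrite mevalB !eval mdeg_proj_red_mnm prod_proj_red_mnm //.
exact: subrr.
Qed.

Lemma sub_proj_red_vanishing (f : {mpoly k[m.+1]}) :
  f - proj_red #|F| f \in I.
Proof.
rewrite sub_proj_redE; apply: rpred_sum => mu _; rewrite -mul_mpolyC.
by apply: ideal_genM; exact: monomial_sub_proj_red_vanishing.
Qed.

(* Take a monomial [la] of [f] with [l = last_var la] minimal.  Weights on the
   points with coordinates [1] at [l] and [0] beyond [l] kill every monomial of
   the same degree except [la]. *)
Lemma reduced_vanishing_eq0 (f : {mpoly k[m.+1]}) :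
  projectively_reduced #|F| f -> f \in I -> f = 0.
Proof.
have F1 := finNzRing_gt1 F.
move=> /(projectively_reducedP _ F1) fred fI.
suff no_supp n (la : 'X_{1..m.+1}) : la \in msupp f -> last_var la = n -> False.
  apply/mpolyP => mu; rewrite mcoeff0; apply: memN_msupp_eq0.
  by apply/negP => /no_supp/(_ (erefl _)).
elim/ltn_ind: n la => n IHn la laf lan.
have [w wE] := card_dual_weights F.
pose l := Ordinal (last_var_lt la).
pose W (i : 'I_m.+1) (x : F) : F :=
  if (i < l)%N then w (la i) x else if i == l then (x == 1)%:R else (x == 0)%:R.
have sum_indicator (y : F) b : \sum_x (x == y)%:R * x ^+ b = y ^+ b.
  rewrite (bigD1 y) //= eqxx mul1r big1 ?addr0 // => x /negbTE ->.
  by rewrite mul0r.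
(* This weight ignores the exponent at [l]; equality of degrees recovers it below. *)
have W_l b : \sum_x W l x * x ^+ b = 1.
  by rewrite /W ltnn eqxx sum_indicator expr1n.
have W_gt (i : 'I_m.+1) b : (l < i)%N ->
    \sum_x W i x * x ^+ b = (b == 0%N)%:R.
  move=> li; rewrite /W ltnNge (ltnW li) /= gt_eqF // sum_indicator.
  exact: expr0n.
have red_lt (mu : 'X_{1..m.+1}) (i : 'I_m.+1) : mu \in msupp f ->
    (i < last_var mu)%N -> (mu i < #|F|)%N.
  by move=> /fred muE; exact: proj_red_mnm_ltn.
have WE (be : 'X_{1..m.+1}) : be \in msupp f -> mdeg be = mdeg la ->
    \prod_i \sum_x W i x * x ^+ be i = (be == la)%:R.
  move=> bef dbe; have [l_be|] := ltnP l (last_var be).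
    have be0 : be != 0%MM.
      apply: contraTneq l_be => ->; rewrite -leqNgt /last_var big_pred0 // => i.
      by rewrite mnmE.
    have /negbTE -> : be != la by apply: contraTneq l_be => ->; rewrite ltnn.
    (* The last variable of [be] lies beyond [l], where the weight evaluates at 0 and kills its
       positive power. *)
    have [j jE bej] := last_varP be0; rewrite (bigD1 j) //= W_gt -?jE //.
    by rewrite (gtn_eqF bej) mul0r.
  rewrite leq_eqVlt => /orP[/eqP be_l|]; last first.
    by rewrite /= lan => be_l; case: (IHn _ be_l be bef).
  have W_lt (i : 'I_m.+1) : (i < l)%N ->
      \sum_x W i x * x ^+ be i = (be i == la i)%:R.
    by move=> il; rewrite /W il wE ?red_lt // be_l.
  have after (i : 'I_m.+1) : (l < i)%N -> be i = la i.
    by move=> li; rewrite !mnm_after_last_var // be_l.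
  have [i /andP[il /negbTE be_la]|eq_lt] := pickP
      [pred i : 'I_m.+1 | (i < l)%N && (be i != la i)].
    rewrite (bigD1 i) //= W_lt // be_la mul0r.
    by rewrite (_ : (be == la) = false) //; apply: contraFF be_la => /eqP ->.
  have ne_l (i : 'I_m.+1) : i != l -> be i = la i.
    have [il _|li _|/val_inj ->] := ltngtP i l; last by rewrite eqxx.
      by have := eq_lt i; rewrite /= il => /negbFE/eqP.
    exact: after.
  have -> : be = la.
    apply/mnmP => i; have [->|/ne_l //] := eqVneq i l.
    move: dbe; rewrite !mdegE (bigD1 l) // [RHS](bigD1 l) //=.
    by rewrite (eq_bigr la) => [/addIn|j /ne_l].
  rewrite eqxx; apply: big1 => i _; have [il|li|/val_inj ->] := ltngtP i l.
  - rewrite /W il wE ?eqxx ?red_lt //.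
  - by rewrite W_gt // mnm_after_last_var.
  - exact: W_l.
have : \sum_(v : {ffun 'I_m.+1 -> F}) iota (\prod_i W i (v i)) *
   (\sum_(mu <- msupp f | mdeg mu == mdeg la)
      f@_mu * iota (\prod_i v i ^+ mu i)) = 0.
  (* The weight is zero unless [v l] is 1; in that case [v] is nonzero and the homogeneous component
     vanishes there. *)
  apply: big1 => v _; have [vl1|vl1] := eqVneq (v l) 1.
    rewrite mem_vanishing_ideal_homog ?mulr0 //.
    by exists l; rewrite vl1 oner_eq0.
  rewrite (bigD1 l) //= {1}/W ltnn eqxx (negbTE vl1) mul0r rmorph0 mul0r //.
(* For each monomial, the weighted sum over all points factors into the product in [WE], so only the
   coefficient of [la] remains. *)
under eq_bigr do rewrite mulr_sumr; rewrite exchange_big /=.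
rewrite big_seq_cond.
rewrite (eq_bigr (fun mu => f@_mu * (mu == la)%:R)) => [|mu /andP[muf /eqP dmu]].
  rewrite -big_seq_cond big_mkcond (bigD1_seq la) ?msupp_uniq //= !eqxx.
  rewrite big1 => [/eqP|mu /negbTE ->]; last by rewrite mulr0 if_same.
  by rewrite mulr1 addr0 -[_ == 0]negbK -mcoeff_msupp laf.
rewrite -[(mu == la)%:R](rmorph_nat iota) -WE // bigA_distr_bigA rmorph_sum.
rewrite mulr_sumr; apply: eq_bigr => v _.
by rewrite mulrCA -rmorphM -big_split.
Qed.

End VanishingIdeal.

(** * The ideal of leading terms and the two quotients *)

(** Such a [mu] is a multiple of the leading monomial of some element of the ideal; multiplying that
    element by the cofactor makes [mu] itself leading. *)
Lemma mem_LT_msupp n (R : comNzRingType) (ord : rel 'X_{1..n})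
    (G : {mpoly R[n]} -> Prop) (f : {mpoly R[n]}) mu :
  monomial_order ord -> f \in LT ord (ideal_gen G) -> mu \in msupp f ->
  exists h, [/\ h \in ideal_gen G, mu \in msupp h
    & forall nu, nu \in msupp h -> ord nu mu].
Proof.
move=> ho /asboolP[s [sG ->]] musum.
have /hasP[[a g] ags /=] : has (fun p => mu \in msupp (p.1 * p.2)) s.
  apply: contraLR musum => /hasPn h; rewrite mcoeff_msupp negbK raddf_sum.
  by apply/eqP; rewrite big_seq big1 // => p /h; rewrite mcoeff_msupp negbK => /eqP.
have /= [h [hG h0 ->]] := sG _ ags.
have [hs hmax] := lmP ho h0.
rewrite (perm_mem (msuppMX _ _)) => /mapP[ta _ ->].
exists ('X_[ta] * h); split; first exact: ideal_genM.
  by rewrite mulrC (perm_mem (msuppMX _ _)) addmC map_f.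
move=> nu; rewrite mulrC (perm_mem (msuppMX _ _)) => /mapP[ka /hmax kah ->].
rewrite [(lm _ _ + _)%MM]addmC; apply: ord_mnmD => //.
by case: ho => tot *; case/orP: (tot ta ta).
Qed.

Theorem corollary2p10 (F : finFieldType) (q : nat) (hq : #|F| = q)
    (m : nat) (hm : (0 < m)%N)
    (k : fieldType) (iota : {rmorphism F -> k})
    (hk : forall x : k, algebraicOver iota x)
    (ord : rel 'X_{1..m.+1}) (hord : monomial_order ord)
    (hvar : forall i j : 'I_m.+1, (i < j)%N ->
       ord U_(j)%MM U_(i)%MM /\ U_(j)%MM <> U_(i)%MM :> 'X_{1..m.+1}) :
  let I := vanishing_ideal (@rational_point F k iota m) in
  (forall y : {ideal_quot I},
     exists! f : {mpoly k[m.+1]},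
       projectively_reduced q f /\ \pi_({ideal_quot I}) f = y) /\
  (forall y : {ideal_quot (LT ord I)},
     exists! f : {mpoly k[m.+1]},
       projectively_reduced q f /\ \pi_({ideal_quot (LT ord I)}) f = y).
Proof.
move=> I; subst q; have F1 := finNzRing_gt1 F.
have ord_red mu : ord (proj_red_mnm #|F| mu) mu.
  by apply: ord_proj_red_mnm => // i j /hvar[].
have normal_form (J : zmodClosed {mpoly k[m.+1]}) :
    (forall g, exists2 f, projectively_reduced #|F| f & f - g \in J) ->
    (forall f, projectively_reduced #|F| f -> f \in J -> f = 0) ->
    forall y : {ideal_quot J}, exists! f : {mpoly k[m.+1]},
      projectively_reduced #|F| f /\ \pi_({ideal_quot J}) f = y.
  move=> ex_red red0 y; have [f fred fy] := ex_red (repr y).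
  exists f; split=> [|g [gred gy]].
    by split=> //; rewrite -[RHS]reprK; apply/eqP; rewrite -Quotient.idealrBE.
  apply/eqP; rewrite -subr_eq0; apply/eqP/red0; first exact: projectively_reducedB.
  rewrite Quotient.idealrBE gy -[y]reprK -Quotient.idealrBE //.
split; apply: normal_form.
- move=> g; exists (proj_red #|F| g); first exact: proj_red_reduced.
  by rewrite -rpredN opprB; exact: sub_proj_red_vanishing.
- by move=> f; exact: reduced_vanishing_eq0.
- move=> g; pose red (mu : 'X_{1..m.+1}) := proj_red_mnm #|F| mu == mu.
  (* Non-reduced monomials lie in [LT ord I], so here they are dropped rather than reduced. *)
  pose f := \sum_(mu <- msupp g | red mu) g@_mu *: 'X_[mu].
  exists f.
    apply/projectively_reducedP => // mu; rewrite mcoeff_msupp raddf_sum /= => h.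
    apply/eqP; apply: contraNT h => mured; rewrite big1 // => nu nured.
    rewrite mcoeffZ mcoeffX; case: eqP nured => [->|]; last by rewrite mulr0.
    by rewrite /red (negbTE mured).
  rewrite -rpredN opprB [X in X - _]mpolyE (bigID red) /= addrC addrK.
  apply: rpred_sum => mu mured; rewrite -mul_mpolyC; apply: ideal_genM.
  apply: mem_ideal_gen; exists ('X_[mu] - 'X_[proj_red_mnm #|F| mu]).
  have h0 : 'X_[mu] - 'X_[proj_red_mnm #|F| mu] != 0 :> {mpoly k[m.+1]}.
    apply: contraNneq mured => /mpolyP/(_ mu).
    rewrite mcoeffB !mcoeffX mcoeff0 eqxx /red; case: eqP => //= _ /eqP.
    by rewrite subr0 oner_eq0.
  split=> //; first exact: monomial_sub_proj_red_vanishing.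
  have [] := lmP hord h0; set t := lm _ _ => tsupp tmax; congr 'X_[_].
  have [_ anti _ _ _] := hord; apply: anti; apply/andP; split.
    apply: tmax; move: mured; rewrite mcoeff_msupp mcoeffB !mcoeffX eqxx /red.
    by move=> /negbTE ->; rewrite subr0 oner_eq0.
  move: tsupp; rewrite mcoeff_msupp mcoeffB !mcoeffX.
  have [<- _|_] := eqVneq mu t; first by case: hord => tot *; case/orP: (tot mu mu).
  by have [<- _|_] := eqVneq (proj_red_mnm _ _) t; [exact: ord_red | rewrite subrr eqxx].
- move=> f /(projectively_reducedP _ F1) fred fLT.
  apply/mpolyP => mu; rewrite mcoeff0; apply: memN_msupp_eq0; apply/negP => muf.
  have [h [hI muh hmax]] := mem_LT_msupp hord fLT muf.
  have red0 : proj_red #|F| h = 0.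
    apply: (@reduced_vanishing_eq0 _ _ iota); first exact: proj_red_reduced.
    by rewrite -[X in X \in _](subKr h) rpredB ?sub_proj_red_vanishing.
  have := congr1 (mcoeff mu) red0; rewrite mcoeff_proj_red mcoeff0 => /eqP.
  apply/negP; rewrite big_seq_cond (eq_bigl (pred1 mu)); last first.
    (* If [nu] in the support reduces to [mu], then [mu] is at most [nu] by [ord_red] and at least
       [nu] by maximality, so no other term can cancel the coefficient. *)
    move=> nu; apply/andP/eqP => [[nuh /eqP numu]|->]; last by rewrite fred.
    have [_ anti _ _ _] := hord; apply: anti.
    by rewrite hmax // -[in X in ord X _]numu ord_red.
  by rewrite -big_filter filter_pred1_uniq ?msupp_uniq // big_seq1 -mcoeff_msupp.
Qed.
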